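(* Let $G$ be a simple connected graph with $n$ nodes and $m$ edges, let $q$ be a positive integer, and let $R_q(G)$ be its $q$-triangulation graph. Then the additive degree-Kirchhoff index satisfies $$\bar{\mathcal K}(R_q(G))=\frac{2(2q+1)}{q+2}\bar{\mathcal K}(G)+\frac{2q(2q+1)}{q+2}\hat{\mathcal K}(G)+m^2q(3q+1)-mq(2n-1)+\frac{(5m-n)(n-1)q}{q+2}.$$
   Context: For a positive integer $q$, the $q$-triangulation graph $R_q(G)$ is obtained from $G$ by keeping all nodes and edges of $G$ and adding, for each edge $uv$ of $G$, $q$ disjoint paths of length $2$: $ux_1v,\dots,ux_qv$, where $x_1,\dots,x_q$ are new nodes. The resistance distance $r_{ij}$ between nodes $i,j$ of a simple connected graph is the effective resistance between them when every edge is replaced by a unit resistor. With $d_i$ the degree of node $i$, the additive degree-Kirchhoff index is $\bar{\mathcal K}(G)=\sum_{\{i,j\}\subseteq V(G)}(d_i+d_j)r_{ij}=\frac12\sum_{i,j}(d_i+d_j)r_{ij}$ and the multiplicative degree-Kirchhoff index is $\hat{\mathcal K}(G)=\sum_{\{i,j\}\subseteq V(G)}d_id_jr_{ij}=\frac12\sum_{i,j}d_id_jr_{ij}$. *)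

(* Defs.v *)
From HB Require Import structures.
From mathcomp Require Import all_boot all_order all_algebra.
From mathcomp Require Import lra.

Set Implicit Arguments.
Unset Strict Implicit.
Unset Printing Implicit Defensive.

Import Order.TTheory GRing.Theory Num.Theory.

Local Open Scope ring_scope.

Record sgraph := SGraph {
  vertex :> finType;
  adj : rel vertex;
  adj_sym : symmetric adj;
  adj_irr : irreflexive adj
}.
Arguments adj {s} x y.

Definition edges (G : sgraph) : {set {set G}} :=
  [set [set p.1; p.2] | p : G * G & adj p.1 p.2].

Definition edge_of (G : sgraph) : finType := {A : {set G} | A \in edges G}.

Definition deg (G : sgraph) (x : G) : nat := #|[set y : G | adj x y]|.

Definition connected_graph (G : sgraph) : Prop :=
  forall x y : G, connect (@adj G) x y.

(* [inr (A, k)] is the midpoint of the k-th new path joining the two ends of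
   the edge A; it is adjacent to exactly these two ends. *)
Definition qtri_adj (q : nat) (G : sgraph)
    (a b : (G + edge_of G * 'I_q)%type) : bool :=
  match a, b with
  | inl u, inl v => adj u v
  | inl u, inr (A, _) => u \in val A
  | inr (A, _), inl u => u \in val A
  | inr _, inr _ => false
  end.

Fact qtri_sym q G : symmetric (@qtri_adj q G).
Proof. by move=> [u|[A k]] [v|[B l]] //=; apply: adj_sym. Qed.

Fact qtri_irr q G : irreflexive (@qtri_adj q G).
Proof. by move=> [u|[A k]] //=; apply: adj_irr. Qed.

Definition q_triangulation (q : nat) (G : sgraph) : sgraph :=
  SGraph (@qtri_sym q G) (@qtri_irr q G).

Section Resistance.
Variables (R : realFieldType) (G : sgraph).

(* Every edge is a unit resistor, so by Ohm's law it carries the current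
   v x - v y; a unit current enters the network at i and leaves it at j. *)
Definition unit_current (i j : G) (v : G -> R) : Prop :=
  forall x : G,
    \sum_(y : G | adj x y) (v x - v y) = (x == i)%:R - (x == j)%:R.

Definition laplacian : 'M[R]_#|G| :=
  \matrix_(a, b) (if a == b then (deg (enum_val a))%:R
                  else - (adj (enum_val a) (enum_val b))%:R).

Definition injection (i j : G) : 'rV[R]_#|G| :=
  delta_mx 0 (enum_rank i) - delta_mx 0 (enum_rank j).

Definition potential (i j x : G) : R :=
  (injection i j *m pinvmx laplacian) 0 (enum_rank x).

(* [pinvmx] merely selects one solution of Kirchhoff's equations; the lemmas
   [potential_unit_current] and [resistance_unit_current] below show that on a
   connected graph a solution exists and the choice does not matter. *)
Definition resistance (i j : G) : R := potential i j i - potential i j j.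

Definition additive_dK : R :=
  2^-1 * \sum_(i : G) \sum_(j : G)
    ((deg i)%:R + (deg j)%:R) * resistance i j.

Definition multiplicative_dK : R :=
  2^-1 * \sum_(i : G) \sum_(j : G)
    (deg i)%:R * (deg j)%:R * resistance i j.

Let row_of (v : G -> R) : 'rV[R]_#|G| := \row_a v (enum_val a).

Lemma mul_laplacian (v : G -> R) (x : G) :
  (row_of v *m laplacian) 0 (enum_rank x) =
  \sum_(y : G | adj x y) (v x - v y).
Proof.
rewrite mxE (reindex _ (onW_bij _ (@enum_rank_bij G))) /=.
rewrite (bigD1 x) //= !mxE eqxx enum_rankK sumrB sumr_const.
rewrite [deg x]cardsE mulr_natr; congr (_ + _).
rewrite -sumrN [RHS]big_mkcond [RHS](bigD1 x) //= adj_irr add0r.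
apply: eq_bigr => y yx; rewrite !mxE !enum_rankK (inj_eq enum_rank_inj).
rewrite (negPf yx) adj_sym mulrN mulr_natr.
by case: (adj x y); rewrite ?mulr1n ?mulr0n ?oppr0.
Qed.

Hypothesis Gconn : connected_graph G.

Lemma harmonic_const (v : G -> R) :
  (forall x : G, \sum_(y : G | adj x y) (v x - v y) = 0) ->
  forall x y, v x = v y.
Proof.
move=> hv x0 y0.
pose z := [arg max_(z > x0) v z]%O.
have zmax w : v w <= v z by rewrite /z; case: Order.TotalTheory.arg_maxP => // i _; apply.
have step x y : adj x y -> v x = v z -> v y = v z.
  move=> xy vx; have /eqP := hv x.
  rewrite psumr_eq0 => [|w _]; last by rewrite subr_ge0 vx.
  by move=> /allP /(_ y (mem_index_enum y)); rewrite xy subr_eq0 vx => /eqP.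
suff vz w : v w = v z by rewrite !vz.
have /connectP [p pth ->] := Gconn z w.
move: {w} (erefl (v z)) pth; elim: p {1 3 4}z => [|y p IHp] x //= vx.
by move=> /andP [xy pth]; apply: IHp => //; apply: step xy vx.
Qed.

Lemma row_ofK (u : 'rV[R]_#|G|) : row_of (fun x => u 0 (enum_rank x)) = u.
Proof. by apply/rowP => a; rewrite mxE enum_valK. Qed.

Lemma injectionE i j x :
  injection i j 0 (enum_rank x) = (x == i)%:R - (x == j)%:R.
Proof. by rewrite !mxE /= !(inj_eq enum_rank_inj). Qed.

Lemma injection_sub i j : (injection i j <= laplacian)%MS.
Proof.
pose one : 'cV[R]_#|G| := const_mx 1.
have lap1 : laplacian *m one = 0.
  have lapT : laplacian^T = laplacian.
    apply/matrixP => a b; rewrite !mxE eq_sym adj_sym.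
    by case: eqP => // ->.
  apply: trmx_inj; rewrite trmx_mul lapT trmx0.
  have -> : one^T = row_of (fun _ => 1) by apply/rowP => a; rewrite !mxE.
  apply/rowP => a; rewrite -[a]enum_valK mul_laplacian mxE.
  by rewrite big1 // => y _; rewrite subrr.
have sub : (laplacian <= kermx one)%MS by apply/sub_kermxP.
have ker1 : (kermx laplacian <= (one^T : 'rV_#|G|))%MS.
  apply/row_subP => a; set u := row a _.
  have uL : u *m laplacian = 0 by rewrite -row_mul mulmx_ker row0.
  have cst := @harmonic_const (fun x => u 0 (enum_rank x)) _.
  have {}cst : forall b c, u 0 b = u 0 c.
    move=> b c; rewrite -[b]enum_valK -[c]enum_valK; apply: cst => x.
    by rewrite -(mul_laplacian (fun x => u 0 (enum_rank x))) row_ofK uL mxE.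
  suff -> : u = u 0 (enum_rank i) *: one^T by apply: scalemx_sub.
  move: {uL} u cst => u cst.
  by apply/rowP => b; rewrite !mxE mulr1; apply: cst.
have rk : \rank laplacian = \rank (kermx one).
  apply/eqP; rewrite eqn_leq mxrankS //=.
  have := mxrankS ker1; rewrite mxrank_tr !mxrank_ker leq_subCl => h.
  by [].
have [_ /esym eqLK] := mxrank_leqif_sup sub.
have {eqLK} KL : (kermx one <= laplacian)%MS by rewrite eqLK rk.
apply: submx_trans KL; apply/sub_kermxP; rewrite mulmxBl -!rowE.
by apply/rowP => b; rewrite !mxE subrr.
Qed.

Lemma potential_unit_current i j : unit_current i j (potential i j).
Proof.
by move=> x; rewrite -mul_laplacian row_ofK mulmxKpV ?injection_sub ?injectionE.
Qed.

Lemma resistance_unit_current i j (v : G -> R) :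
  unit_current i j v -> resistance i j = v i - v j.
Proof.
move=> hv; pose w x := v x - potential i j x.
have hw x : \sum_(y : G | adj x y) (w x - w y) = 0.
  rewrite -[RHS](subrr ((x == i)%:R - (x == j)%:R)).
  rewrite -{1}(hv x) -(potential_unit_current i j x) -sumrB.
  by apply: eq_bigr => y _; rewrite /w; lra.
by have := harmonic_const hw i j; rewrite /w /resistance; lra.
Qed.

End Resistance.

(* Main.v *)
Require Import Defs.
From mathcomp Require Import all_boot all_order all_algebra.
From mathcomp Require Import ring lra.
Import GRing.Theory Num.Theory.
Local Open Scope ring_scope.

Set Implicit Arguments.
Unset Strict Implicit.
Unset Printing Implicit Defensive.

(** Write [H] for the q-triangulation, [c = 2 / (q + 2)], [L] for the Laplacian
    and [r] for the resistance of [G].  The proof computes every resistance of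
    [H] in terms of [r] and then sums.

    Resistances can be recognised by a Laplace equation: a symmetric function
    [rho] vanishing on the diagonal is the resistance as soon as
    [L (rho(., j) - rho(., i)) = 2 (delta_i - delta_j)], because
    [(rho(., j) - rho(., i)) / 2] is then the potential of a unit current from
    [i] to [j] ([resistance_unique]).  Conversely [L r(., i)] equals
    [-2 delta_i] plus a function that does not depend on [i]
    ([lap_resistance]); summing this over all vertices gives Foster's theorem.

    A function on [G] extends to [H] by averaging over the two ends of each
    edge.  This extension is harmonic at the new vertices, and at the old ones
    its Laplacian is [1/c] times that of [G] ([lap_extend_old],
    [lap_extend_new]): a path of length 2 is a conductor of value 1/2, so an
    edge with its [q] paths conducts like [1 + q/2] edges.  With [pi_z] the
    averaging weights of a vertex [z] of [H] and
    [Q(z, w) = sum_(u, v) pi_z(u) pi_w(v) r(u, v)], one gets for [z != w]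
      [r_H(z, w) = ([z is new] + [w is new]) / 2
                   + c (Q(z, w) - Q(z, z) / 2 - Q(w, w) / 2)]
    ([resistance_triangulation]).  A new vertex is joined to the middle of its
    edge through two unit resistors in parallel, whence the 1/2.

    In the index of [H], the total weights [sum_z pi_z] and
    [sum_z deg(z) pi_z] are affine functions of the degree in [G], so that the
    terms [Q(z, w)] add up to the two indices of [G]; the diagonal terms
    [Q(z, z)] add up to a multiple of [sum_(uv edge) r(u, v)], which is
    [n - 1] by Foster's theorem. *)

(** * Sums against indicator functions *)

Section FiniteSums.
Variables (R : pzRingType) (I : finType).

Lemma sum_indicator (i : I) (f : I -> R) : \sum_x (x == i)%:R * f x = f i.
Proof.
rewrite (bigD1 i) //= eqxx mul1r big1 ?addr0 // => x /negPf ->.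
by rewrite mul0r.
Qed.

Lemma sum_mem (A : {set I}) (f : I -> R) :
  \sum_x (x \in A)%:R * f x = \sum_(x in A) f x.
Proof.
by rewrite [RHS]big_mkcond; apply: eq_bigr => x _; case: (x \in A);
  rewrite ?mul1r ?mul0r.
Qed.

End FiniteSums.

(** * The Laplacian of a graph *)

Section Laplacian.
Variables (R : realFieldType) (G : sgraph).
Implicit Types (f g : G -> R) (x y i j : G).

Definition lap f x : R := \sum_(y | adj x y) (f x - f y).

Lemma eq_lap f g : f =1 g -> lap f =1 lap g.
Proof. by move=> fg x; apply: eq_bigr => y _; rewrite !fg. Qed.

Lemma lap_comb a b f g x :
  lap (fun y => a * f y + b * g y) x = a * lap f x + b * lap g x.
Proof.
by rewrite /lap !mulr_sumr -big_split; apply: eq_bigr => y _ /=; ring.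
Qed.

Lemma lapB f g x : lap (fun y => f y - g y) x = lap f x - lap g x.
Proof. by rewrite /lap -sumrB; apply: eq_bigr => y _; ring. Qed.

Lemma lap_shift c f x : lap (fun y => f y + c) x = lap f x.
Proof. by apply: eq_bigr => y _; ring. Qed.

Lemma lap_lincomb (I : finType) (a : I -> R) (F : I -> G -> R) x :
  lap (fun y => \sum_i a i * F i y) x = \sum_i a i * lap (F i) x.
Proof.
under [RHS]eq_bigr do rewrite mulr_sumr.
rewrite exchange_big; apply: eq_bigr => y _.
by rewrite -sumrB; apply: eq_bigr => i _; rewrite mulrBr.
Qed.

Lemma degE x : (deg x)%:R = \sum_(y : G | adj x y) 1 :> R.
Proof. by rewrite sumr_const /deg cardsE. Qed.

Lemma lap_indicator i x :
  lap (fun y => (y == i)%:R) x = (deg x)%:R * (x == i)%:R - (adj x i)%:R.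
Proof.
rewrite /lap sumrB sumr_const mulr_natl /deg cardsE; congr (_ - _).
rewrite big_mkcond (bigD1 i) //= eqxx big1 => [|y /negPf ->]; last first.
  by rewrite if_same.
by rewrite addr0; case: adj.
Qed.

Lemma sum_adj_swap (F : G -> G -> R) :
  \sum_x \sum_(y | adj x y) F x y = \sum_x \sum_(y | adj x y) F y x.
Proof.
rewrite (exchange_big_dep predT) //=; apply: eq_bigr => x _.
by apply: eq_bigl => y; rewrite adj_sym.
Qed.

(** Green's identity: the Laplacian is self-adjoint. *)
Lemma green f g : \sum_x f x * lap g x = \sum_x g x * lap f x.
Proof.
have expand u v : \sum_x u x * lap v x =
    \sum_x \sum_(y | adj x y) u x * v x - \sum_x \sum_(y | adj x y) u x * v y.
  rewrite -sumrB; apply: eq_bigr => x _.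
  by rewrite mulr_sumr -sumrB; apply: eq_bigr => y _; rewrite mulrBr.
rewrite !expand [X in _ - X]sum_adj_swap.
by congr (_ - _); apply: eq_bigr => x _; apply: eq_bigr => y _; rewrite mulrC.
Qed.

Lemma sum_lap f : \sum_x lap f x = 0.
Proof.
have := green (fun _ => 1) f; under eq_bigr do rewrite mul1r.
move=> ->; apply: big1 => x _.
by rewrite /lap big1 ?mulr0 // => y _; rewrite subrr.
Qed.

End Laplacian.

(** * Resistances and Laplace equations *)

Section Resistance.
Variables (R : realFieldType) (G : sgraph).
Hypothesis Gconn : connected_graph G.
Local Notation r := (@resistance R G).
Local Notation p := (@potential R G).

Lemma lap_potential i j x : lap (p i j) x = (x == i)%:R - (x == j)%:R.
Proof. exact: potential_unit_current. Qed.

(** Pairing [lap (p k l)] with [f] gives [f k - f l]; Green's identity for the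
    two potentials is therefore the reciprocity law. *)
Lemma potential_reciprocity i j x y : p i j x - p i j y = p x y i - p x y j.
Proof.
have E k l f : \sum_z f z * lap (p k l) z = f k - f l.
  transitivity (\sum_z ((z == k)%:R * f z - (z == l)%:R * f z)).
    by apply: eq_bigr => z _; rewrite lap_potential; ring.
  by rewrite sumrB !sum_indicator.
by rewrite -!E green.
Qed.

(** The difference of the two sides is harmonic, hence constant. *)
Lemma potential_superposition i j k x y :
  p i k x - p i k y = (p i j x - p i j y) + (p j k x - p j k y).
Proof.
pose h z := p i k z - p i j z - p j k z.
have hh z : lap h z = 0 by rewrite /h !lapB !lap_potential; ring.
by have := harmonic_const Gconn hh x y; rewrite /h; lra.
Qed.

Lemma resistance_diff i j x :
  r x j - r x i = 2 * p i j x - (p i j i + p i j j).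
Proof.
rewrite /resistance.
have := potential_superposition x i j x j.
have := potential_reciprocity x i i j; lra.
Qed.

Lemma resistance_refl i : r i i = 0.
Proof. by rewrite /resistance subrr. Qed.

Lemma resistance_sym i j : r i j = r j i.
Proof.
have := resistance_diff i j j; have := resistance_diff i j i.
by rewrite !resistance_refl /resistance; lra.
Qed.

(** By [resistance_diff] the Laplacian of [r^~ i - r^~ x] is
    [2 (delta_x - delta_i)].  At the point [x], where [r x x = 0], the Laplacian
    of [r^~ x] is read off from the definition. *)
Lemma lap_resistance i x :
  lap (r^~ i) x = 2 - 2 * (x == i)%:R - \sum_(y | adj x y) r x y.
Proof.
have : lap (fun y => r y i - r y x) x = 2 * (x == x)%:R - 2 * (x == i)%:R.
  rewrite -mulrBr -lap_potential.
  rewrite (eq_lap (g := fun y => 2 * p x i y + - (p x i x + p x i i))).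
  2: by move=> y; rewrite resistance_diff.
  rewrite lap_shift -[RHS]addr0 -(mul0r (lap (p x i) x)) -lap_comb.
  by apply: eq_lap => y; ring.
rewrite lapB eqxx => /eqP; rewrite subr_eq => /eqP ->.
rewrite /lap resistance_refl mulr1; congr (_ + _).
by rewrite -sumrN; apply: eq_bigr => y _; rewrite sub0r resistance_sym.
Qed.

(** Foster's theorem: a Laplacian sums to zero over the graph, so
    [lap_resistance] can be summed for any fixed pole [i].  Each edge is counted
    once in each direction. *)
Lemma foster (i : G) :
  \sum_x \sum_(y | adj x y) r x y = 2 * (#|G|%:R - 1).
Proof.
have := sum_lap (r^~ i); under eq_bigr do rewrite lap_resistance.
rewrite !sumrB sumr_const -mulr_sumr -[#|predT|]/#|G|.
have -> : \sum_x (x == i)%:R = 1 :> R.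
  rewrite -[RHS](sum_indicator i (fun=> 1)).
  by apply: eq_bigr => x _; rewrite mulr1.
by rewrite -mulr_natr; lra.
Qed.

(** [(rho^~ j - rho^~ i) / 2] is a potential for the unit current from [i] to
    [j], and its drop between these vertices is [rho i j]. *)
Lemma resistance_unique (rho : G -> G -> R) :
    (forall i, rho i i = 0) -> (forall i j, rho i j = rho j i) ->
    (forall i j x, lap (fun y => rho y j - rho y i) x =
                   2 * ((x == i)%:R - (x == j)%:R)) ->
  forall i j, r i j = rho i j.
Proof.
move=> rho0 rhoC hrho i j.
pose v y := 2^-1 * rho y j + (- 2^-1) * rho y i.
rewrite (@resistance_unit_current _ _ Gconn i j v); last first.
  move=> x; have := hrho i j x; rewrite lapB => h.
  by rewrite -[LHS]/(lap v x) lap_comb; lra.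
by rewrite /v !rho0 (rhoC j i); lra.
Qed.

Lemma additive_dKE : additive_dK R G = \sum_i \sum_j (deg i)%:R * r i j.
Proof.
rewrite /additive_dK.
have -> : \sum_i \sum_j ((deg i)%:R + (deg j)%:R) * r i j =
   \sum_i \sum_j (deg i)%:R * r i j + \sum_i \sum_j (deg j)%:R * r i j.
  rewrite -big_split; apply: eq_bigr => i _; rewrite -big_split.
  by apply: eq_bigr => j _ /=; rewrite mulrDl.
rewrite [X in _ * (_ + X)]exchange_big /=.
under [X in _ * (_ + X)]eq_bigr do under eq_bigr do rewrite resistance_sym.
by field.
Qed.

End Resistance.

(** * Sums over edges *)

Section Edges.
Variables (R : pzRingType) (G : sgraph).

(** [v |-> [set u; v]] is a bijection from the neighbours of [u] to the edges
    at [u].  With [F] a function of the underlying set, no choice of an ordered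
    pair of ends is ever made. *)
Lemma sum_edges_at (u : G) (F : {set G} -> R) :
  \sum_(A : edge_of G | u \in val A) F (val A) =
  \sum_(v | adj u v) F [set u; v].
Proof.
have inj : {in [pred v | adj u v] &, injective (fun v : G => [set u; v])}.
  move=> v w; rewrite !inE => uv _ /setP /(_ v); rewrite !inE eqxx orbT.
  have /negPf -> : v != u by apply: contraTneq uv => ->; rewrite adj_irr.
  by move=> /= /esym /eqP.
rewrite -(big_imset F inj) /= -(big_sub_cond (edges G) (fun A => u \in A) F).
apply: eq_bigl => A; apply/andP/imsetP => [[/imsetP [[x y]]]|[v uv ->]].
  rewrite inE /= => xy -> /set2P [] ->; first by exists y; rewrite ?inE.
  by exists x; rewrite ?inE 1?adj_sym 1?setUC.
rewrite !inE eqxx in uv *; split=> //.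
by apply/imsetP; exists (u, v); rewrite ?inE.
Qed.

Lemma edge_ends (A : edge_of G) :
  exists u v, [/\ adj u v, u != v & val A = [set u; v]].
Proof.
have /imsetP [[u v]] := valP A; rewrite inE /= => uv ->.
exists u, v; split=> //; apply: contraTneq (uv : adj u v) => ->.
by rewrite adj_irr.
Qed.

Lemma card_edge (A : edge_of G) : #|val A| = 2.
Proof. by have [u [v [_ uv ->]]] := edge_ends A; rewrite cards2 uv. Qed.

Lemma sum_edge_darts (F : G -> {set G} -> R) :
  \sum_(A : edge_of G) \sum_(u in val A) F u (val A) =
  \sum_u \sum_(v | adj u v) F u [set u; v].
Proof.
rewrite (exchange_big_dep predT) //=; apply: eq_bigr => u _.
exact: (sum_edges_at u (F u)).
Qed.

Lemma handshake : \sum_(u : G) (deg u)%:R = 2 * #|edges G|%:R :> R.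
Proof.
transitivity (\sum_(A : edge_of G) \sum_(u in val A) (1 : R)).
  rewrite (sum_edge_darts (fun _ _ => 1)).
  by apply: eq_bigr => u _; rewrite sumr_const /deg cardsE.
under eq_bigr do rewrite sumr_const card_edge.
by rewrite sumr_const -[#|_|]/#|edge_of G| card_sig mulr_natr.
Qed.

End Edges.

(** * The q-triangulation and its Laplacian *)

Section Triangulation.
Variables (R : realFieldType) (G : sgraph) (q : nat).
Local Notation H := (q_triangulation q G).
Local Notation old u := (inl u : H).
Local Notation new A k := (inr (A, k) : H).

Lemma sum_triangulation (F : H -> R) :
  \sum_z F z =
  \sum_u F (old u) + \sum_(A : edge_of G) \sum_(k < q) F (new A k).
Proof.
rewrite big_sumType pair_big /=; congr (_ + _).
by apply: eq_bigr => -[A k].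
Qed.

Lemma sum_adj_old u (F : H -> R) :
  \sum_(w | adj (old u) w) F w =
  \sum_(v | adj u v) F (old v)
  + \sum_(A : edge_of G | u \in val A) \sum_(k < q) F (new A k).
Proof.
rewrite big_sumType pair_big_dep /=; congr (_ + _).
by apply: eq_big => [[A k]|[A k] _] //=; rewrite andbT.
Qed.

Lemma sum_adj_new A k (F : H -> R) :
  \sum_(w | adj (new A k) w) F w = \sum_(u in val A) F (old u).
Proof. by rewrite big_sumType /= [X in _ + X]big_pred0 ?addr0 // => -[]. Qed.

Lemma deg_old u : (deg (old u))%:R = (q%:R + 1) * (deg u)%:R :> R.
Proof.
rewrite !degE sum_adj_old.
rewrite (sum_edges_at u (fun=> \sum_(k < q) 1)) !sumr_const card_ord.
by rewrite -(mulr_natr q%:R); ring.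
Qed.

Lemma deg_new A k : (deg (new A k))%:R = 2 :> R.
Proof. by rewrite degE sum_adj_new sumr_const card_edge. Qed.

Lemma triangulation_connected : connected_graph G -> connected_graph H.
Proof.
move=> Gconn.
have old_old u v : connect (@adj H) (old u) (old v).
  have /connectP [s] := Gconn u v; elim: s u => [|w s IHs] u /=.
    by move=> _ ->.
  move=> /andP [uw ws] /(IHs _ ws); apply: connect_trans.
  exact: connect1.
have to_old z : exists u, connect (@adj H) z (old u).
  case: z => [u|[A k]]; first by exists u.
  have [u [v [_ _ eA]]] := edge_ends A; exists u.
  by apply: connect1; rewrite /= eA !inE eqxx.
move=> z w; have [u zu] := to_old z; have [v wv] := to_old w.
apply: connect_trans zu (connect_trans (old_old u v) _).
by rewrite (sym_connect_sym (@adj_sym H)).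
Qed.

(** The harmonic measure on [G] seen from [z]: where a random walk from [z]
    first meets an old vertex. *)
Definition weight (z : H) (v : G) : R :=
  match z with
  | inl u => (v == u)%:R
  | inr (A, _) => 2^-1 * (v \in val A)%:R
  end.

Definition extend (f : G -> R) (z : H) : R := \sum_v weight z v * f v.

Lemma extend_old f u : extend f (old u) = f u.
Proof. exact: sum_indicator. Qed.

Lemma extend_new f A k : extend f (new A k) = 2^-1 * \sum_(u in val A) f u.
Proof.
rewrite -sum_mem mulr_sumr; apply: eq_bigr => u _ /=.
by rewrite mulrA.
Qed.

Lemma sum_weight z : \sum_v weight z v = 1.
Proof.
have -> : \sum_v weight z v = extend (fun=> 1) z.
  by apply: eq_bigr => v _; rewrite mulr1.
case: z => [u|[A k]]; first by rewrite extend_old.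
by rewrite extend_new sumr_const card_edge; field.
Qed.

(** The midpoint of a path over the edge [uv] sits at the mean of its two ends,
    so each of the [q] paths carries the current [(f u - f v) / 2]. *)
Lemma lap_extend_old f u :
  lap (extend f) (old u) = (q%:R + 2) / 2 * lap f u.
Proof.
rewrite /lap sum_adj_old.
under eq_bigr do rewrite !extend_old.
under [X in _ + X]eq_bigr do under eq_bigr do rewrite extend_old extend_new.
rewrite (sum_edges_at u
  (fun A => \sum_(k < q) (f u - 2^-1 * \sum_(v in A) f v))).
rewrite -big_split mulr_sumr; apply: eq_bigr => v uv /=.
rewrite big_setU1 ?big_set1 /=; last first.
  by rewrite inE; apply: contraTneq uv => ->; rewrite adj_irr.
by rewrite sumr_const card_ord -[(_ - _) *+ q]mulr_natr; field.
Qed.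

Lemma lap_extend_new f A k : lap (extend f) (new A k) = 0.
Proof.
rewrite /lap sum_adj_new sumrB.
under [X in _ - X]eq_bigr do rewrite extend_old.
by rewrite sumr_const card_edge extend_new mulr2n; field.
Qed.

Definition is_new (z : H) : R := if z is inr _ then 1 else 0.

(** For a new [w], the values at the old vertices cancel the poles of
    [energy^~ w], which lie at the ends of the edge of [w] and not at [w]. *)
Lemma lap_spike w z :
  is_new w * lap (fun y => (y == w)%:R) z =
  2 * (z == w)%:R - 2 * (if z is inl u then weight w u else 0).
Proof.
rewrite lap_indicator; case: w z => [v|[B l]] [u|[A k]] //=.
- by rewrite -[inl u == inl v]/(u == v); ring.
- by rewrite mul0r mulr0 subrr.
- by field.
by rewrite deg_new; ring.
Qed.

(** * Resistances of the q-triangulation *)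

Hypothesis Gconn : connected_graph G.
Local Notation r := (@resistance R G).
Local Notation c := (2 / (q%:R + 2) : R).

Lemma q2_neq0 : q%:R + 2 != 0 :> R.
Proof. by rewrite -natrD pnatr_eq0 addn2. Qed.

(** The form [Q] of the introduction. *)
Definition energy (z w : H) : R := extend (fun u => extend (r u) w) z.

Lemma energyE z w :
  energy z w = \sum_u \sum_v weight z u * weight w v * r u v.
Proof.
apply: eq_bigr => u _; rewrite mulr_sumr.
by apply: eq_bigr => v _; rewrite mulrA.
Qed.

Lemma energy_sym z w : energy z w = energy w z.
Proof.
rewrite !energyE exchange_big; apply: eq_bigr => u _; apply: eq_bigr => v _ /=.
by rewrite (resistance_sym R Gconn) (mulrC (weight z _)).
Qed.

Definition triangulation_resistance (z w : H) : R :=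
  (z != w)%:R * (is_new z + is_new w) / 2
  + c * (energy z w - energy z z / 2 - energy w w / 2).

Lemma triangulation_resistanceE z w :
  triangulation_resistance z w =
  (is_new z + is_new w) / 2 - is_new w * (z == w)%:R
  + c * (energy z w - energy z z / 2 - energy w w / 2).
Proof.
rewrite /triangulation_resistance; congr (_ + _).
by case: eqP => [->|_] /=; field.
Qed.

(** The right-hand side depends on [w] only through its pole [-2 delta_w]:
    this is the form of the Laplacian of a resistance. *)
Lemma lap_energy w z :
  lap (fun y => c * energy y w + - is_new w * (y == w)%:R) z =
  (if z is inl u then 2 - \sum_(y | adj u y) r u y else 0) - 2 * (z == w)%:R.
Proof.
rewrite (lap_comb c (- is_new w) (energy^~ w)) mulNr lap_spike.
case: z => [u|[A k]]; last by rewrite lap_extend_new; ring.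
rewrite lap_extend_old lap_lincomb.
set mu := \sum_(y | adj u y) r u y.
have -> : \sum_v weight w v * lap (r^~ v) u = 2 - mu - 2 * weight w u.
  transitivity
    (\sum_v ((2 - mu) * weight w v - 2 * ((v == u)%:R * weight w v))).
    apply: eq_bigr => v _; rewrite (lap_resistance R Gconn) (eq_sym u) -/mu.
    by ring.
  by rewrite sumrB -!mulr_sumr sum_weight sum_indicator mulr1.
by field; exact: q2_neq0.
Qed.

Lemma resistance_triangulation z w :
  resistance R z w = triangulation_resistance z w.
Proof.
apply: (resistance_unique (triangulation_connected Gconn)) => [i|i j|i j x].
- by rewrite /triangulation_resistance eqxx /=; field; exact: q2_neq0.
- by rewrite /triangulation_resistance eq_sym energy_sym; field; exact: q2_neq0.
(* The terms of the resistance between [y] and [k] that depend on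
   both; those in [y] alone cancel in the difference and those in [k] alone are
   constants. *)
pose pole k y := c * energy y k + - is_new k * (y == k)%:R.
have -> : 2 * ((x == i)%:R - (x == j)%:R) = lap (pole j) x - lap (pole i) x.
  by rewrite !lap_energy; ring.
rewrite -lapB -[RHS](lap_shift ((is_new j - c * energy j j
                                 - (is_new i - c * energy i i)) / 2)).
apply: eq_lap => y; rewrite !triangulation_resistanceE /pole.
by field; exact: q2_neq0.
Qed.

(** * Summation *)

Lemma sum_is_new : \sum_z is_new z = #|edges G|%:R * q%:R.
Proof.
rewrite sum_triangulation /= big1 // add0r.
under eq_bigr do rewrite sumr_const card_ord.
by rewrite sumr_const -[#|_|]/#|edge_of G| card_sig mulr_natl.
Qed.

Lemma card_triangulation : #|H|%:R = #|G|%:R + #|edges G|%:R * q%:R :> R.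
Proof. by rewrite /= card_sum card_prod card_ord card_sig natrD natrM. Qed.

Lemma sum_deg_is_new : \sum_(z : H) (deg z)%:R * is_new z =
  2 * (#|edges G|%:R * q%:R).
Proof.
rewrite -sum_is_new mulr_sumr; apply: eq_bigr => -[u|[A k]] _ /=.
  by rewrite !mulr0.
by rewrite deg_new.
Qed.

Lemma sum_deg_triangulation :
  \sum_(z : H) (deg z)%:R = 2 * #|edges G|%:R * (2 * q%:R + 1) :> R.
Proof.
rewrite sum_triangulation.
under eq_bigr do rewrite deg_old.
under [X in _ + X]eq_bigr do under eq_bigr do rewrite deg_new -[2]mulr1.
rewrite -mulr_sumr handshake.
under [X in _ + X]eq_bigr do rewrite -mulr_sumr sumr_const card_ord.
rewrite -mulr_sumr sumr_const -[#|_ : pred (edge_of G)|]/#|edge_of G| card_sig.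
by rewrite -[q%:R *+ _]mulr_natr; ring.
Qed.

Lemma sum_weight_new (u : G) (d : R) :
  \sum_(A : edge_of G) \sum_(k < q) d * weight (new A k) u =
  d * q%:R / 2 * (deg u)%:R.
Proof.
transitivity (\sum_(A : edge_of G | u \in val A) d * q%:R / 2).
  rewrite [RHS]big_mkcond; apply: eq_bigr => A _ /=.
  rewrite sumr_const card_ord; case: (u \in _) => /=.
    by rewrite -mulr_natr; ring.
  by rewrite !mulr0 mul0rn.
rewrite (sum_edges_at u (fun=> d * q%:R / 2)) degE mulr_sumr.
by apply: eq_bigr => v _; rewrite mulr1.
Qed.

Lemma sum_weight_vertices u : \sum_z weight z u = 1 + q%:R / 2 * (deg u)%:R.
Proof.
rewrite sum_triangulation -[q%:R]mul1r -sum_weight_new.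
congr (_ + _).
  rewrite -[RHS](sum_indicator u (fun=> 1)).
  by apply: eq_bigr => v _; rewrite mulr1 /= eq_sym.
by apply: eq_bigr => A _; apply: eq_bigr => k _; rewrite mul1r.
Qed.

Lemma sum_deg_weight u :
  \sum_(z : H) (deg z)%:R * weight z u = (2 * q%:R + 1) * (deg u)%:R.
Proof.
rewrite sum_triangulation.
under [X in _ + X]eq_bigr do under eq_bigr do rewrite deg_new.
rewrite sum_weight_new.
have -> : \sum_v (deg (old v))%:R * weight (old v) u = (q%:R + 1) * (deg u)%:R.
  rewrite -deg_old -(sum_indicator u (fun v => (deg (old v))%:R)).
  by apply: eq_bigr => v _; rewrite mulrC /= eq_sym.
by field.
Qed.

Local Notation phi := (\sum_u \sum_(v | adj u v) r u v).

Lemma energy_new_refl A k :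
  energy (new A k) (new A k) =
  4^-1 * \sum_(u in val A) \sum_(v in val A) r u v.
Proof.
rewrite /energy extend_new; under eq_bigr do rewrite extend_new.
by rewrite -mulr_sumr; field.
Qed.

(** Only new vertices contribute, since [energy] vanishes on the diagonal at
    the old ones. *)
Lemma sum_energy (a : H -> R) (d : R) :
    (forall A k, a (new A k) = d) ->
  \sum_z a z * energy z z = d * q%:R / 4 * phi.
Proof.
move=> ad; rewrite sum_triangulation big1 => [|u _]; last first.
  by rewrite /energy !extend_old resistance_refl mulr0.
transitivity (\sum_(A : edge_of G)
    d * q%:R / 4 * \sum_(u in val A) \sum_(v in val A) r u v).
  rewrite add0r; apply: eq_bigr => A _.
  under eq_bigr do rewrite ad energy_new_refl.
  by rewrite sumr_const card_ord -[_ *+ q]mulr_natr; ring.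
rewrite -mulr_sumr (sum_edge_darts (fun u A => \sum_(v in A) r u v)).
congr (_ * _); apply: eq_bigr => u _; apply: eq_bigr => v uv.
rewrite big_setU1 ?big_set1 /= ?resistance_refl ?add0r //.
by rewrite inE; apply: contraTneq uv => ->; rewrite adj_irr.
Qed.

Lemma sum_deg_energy :
  \sum_(z : H) \sum_(w : H) (deg z)%:R * energy z w =
  (2 * q%:R + 1) * (additive_dK R G + q%:R * multiplicative_dK R G).
Proof.
transitivity (\sum_u \sum_v
    (\sum_(z : H) (deg z)%:R * weight z u) * (\sum_w weight w v) * r u v).
  transitivity (\sum_(z : H) \sum_u \sum_v
      ((deg z)%:R * weight z u) * (\sum_w weight w v) * r u v).
    apply: eq_bigr => z _; under eq_bigr do rewrite energyE.
    rewrite -mulr_sumr exchange_big mulr_sumr; apply: eq_bigr => u _ /=.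
    rewrite exchange_big mulr_sumr; apply: eq_bigr => v _ /=.
    rewrite -mulrA mulr_suml !mulr_sumr; apply: eq_bigr => w _; ring.
  rewrite exchange_big; apply: eq_bigr => u _.
  rewrite exchange_big; apply: eq_bigr => v _.
  by rewrite !mulr_suml.
rewrite (additive_dKE R Gconn) /multiplicative_dK mulrDr !mulrA.
rewrite !mulr_sumr -big_split.
apply: eq_bigr => u _; rewrite !mulr_sumr -big_split; apply: eq_bigr => v _ /=.
by rewrite sum_deg_weight sum_weight_vertices; field.
Qed.

Lemma additive_dK_triangulation :
  additive_dK R H =
    c * (2 * q%:R + 1) * (additive_dK R G + q%:R * multiplicative_dK R G)
    + (#|G|%:R + #|edges G|%:R * (3 * q%:R + 1)) *
      (#|edges G|%:R * q%:R - q%:R / (q%:R + 2) * (phi / 2))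
    - 2 * #|edges G|%:R * q%:R.
Proof.
rewrite (additive_dKE R (triangulation_connected Gconn)).
transitivity (\sum_(z : H) \sum_(w : H) (
   (deg z)%:R * is_new z / 2 + (deg z)%:R * (is_new w / 2)
   - (w == z)%:R * ((deg z)%:R * is_new w)
   + c * ((deg z)%:R * energy z w)
   - c / 2 * ((deg z)%:R * energy z z)
   - c / 2 * (deg z)%:R * energy w w)).
  apply: eq_bigr => z _; apply: eq_bigr => w _.
  rewrite resistance_triangulation triangulation_resistanceE eq_sym.
  by field; exact: q2_neq0.
(* [N] stands for the number of vertices, kept abstract so that simplification
   does not unfold the vertex type. *)
have [N NE] : exists N : R, N = #|H|%:R by exists #|H|%:R.
have sumc (x : R) : \sum_(w : H) x = N * x.
  by rewrite sumr_const NE mulr_natl.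
transitivity (\sum_(z : H) (
   N / 2 * ((deg z)%:R * is_new z)
   + (deg z)%:R * ((\sum_w is_new w) / 2)
   - (deg z)%:R * is_new z
   + c * (\sum_(w : H) (deg z)%:R * energy z w)
   - c / 2 * N * ((deg z)%:R * energy z z)
   - (deg z)%:R * (c / 2 * \sum_w energy w w))).
  apply: eq_bigr => z _.
  rewrite !(sumrB, big_split) /= !sumc sum_indicator.
  rewrite -!mulr_sumr -mulr_suml.
  by field; exact: q2_neq0.
rewrite !(sumrB, big_split) /= -!mulr_sumr -!mulr_suml.
rewrite sum_deg_is_new sum_deg_energy sum_deg_triangulation sum_is_new.
rewrite (sum_energy (d := 2)) => [|A k]; last exact: deg_new.
have -> : \sum_w energy w w = q%:R / 4 * phi.
  rewrite -[q%:R]mul1r -(sum_energy (a := fun=> 1)) //.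
  by apply: eq_bigr => w _; rewrite mul1r.
rewrite NE card_triangulation.
by field; exact: q2_neq0.
Qed.

End Triangulation.

Theorem theorem7 (R : realFieldType) (G : sgraph) (n m q : nat)
    (hG : connected_graph G) (hn : #|G| = n) (hm : #|edges G| = m)
    (hq : (0 < q)%N) :
  additive_dK R (q_triangulation q G) =
    2 * (2 * q%:R + 1) / (q%:R + 2) * additive_dK R G
    + 2 * q%:R * (2 * q%:R + 1) / (q%:R + 2) * multiplicative_dK R G
    + m%:R ^+ 2 * q%:R * (3 * q%:R + 1)
    - m%:R * q%:R * (2 * n%:R - 1)
    + (5 * m%:R - n%:R) * (n%:R - 1) * q%:R / (q%:R + 2).
Proof.
rewrite additive_dK_triangulation // hm hn.
case: (pickP (pred_of_simpl (@predT G))) => [i _|G0].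
  by rewrite (foster R hG i) hn; field; exact: q2_neq0.
(* Foster's theorem needs a vertex; without one, both indices keep the same
   coefficients on the two sides and all other terms vanish with [n] and [m]. *)
have n0 : n = 0%N by rewrite -hn; apply: eq_card0.
have m0 : m%:R = 0 :> R.
  have := handshake R G; rewrite hm big1 => [h|u]; last by have := G0 u.
  lra.
by rewrite m0 n0; field; exact: q2_neq0.
Qed.
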